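(* For all graphs $G$ and $H$, $\gamma_{gr}^{t}(G\times H)\ \ge\ \gamma_{gr}^{t}(G)\,\gamma_{gr}^{t}(H)$.
   Context: Graphs are finite, simple and undirected. $N(v)$ denotes the open neighborhood of $v$. A sequence $(v_1,\ldots,v_k)$ of distinct vertices of $G$ is a (legal) open neighborhood sequence if $N(v_i)\setminus\bigcup_{j=1}^{i-1}N(v_j)\neq\emptyset$ for each $i\in\{1,\ldots,k\}$. The Grundy total domination number $\gamma_{gr}^{t}(G)$ is the maximum length of a legal open neighborhood sequence of $G$ (it is $0$ if $G$ has no edges). The direct product $G\times H$ has vertex set $V(G)\times V(H)$, and $(g_1,h_1)$, $(g_2,h_2)$ are adjacent iff $g_1g_2\in E(G)$ and $h_1h_2\in E(H)$. *)

(* Defs.v *)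
From mathcomp Require Import all_boot.

Set Implicit Arguments.
Unset Strict Implicit.
Unset Printing Implicit Defensive.

Record sgraph := SGraph {
  vertex :> finType;
  adj : rel vertex;
  adj_sym : symmetric adj;
  adj_irrefl : irreflexive adj
}.

Definition open_nbhd (G : sgraph) (v : G) : {set G} := [set w | adj v w].

Definition legal_open_seq (G : sgraph) (k : nat) (s : k.-tuple G) : bool :=
  uniq s &&
  [forall i : 'I_k,
     open_nbhd (tnth s i) :\: \bigcup_(j < k | j < i) open_nbhd (tnth s j)
       != set0].

(* Lengths above #|G| need not be considered: the vertices of a legal sequence
   are distinct (see [leq_grundy_total]). *)
Definition grundy_total (G : sgraph) : nat :=
  \max_(k < #|G|.+1 | [exists s : k.-tuple G, legal_open_seq s]) k.

Lemma leq_grundy_total (G : sgraph) (k : nat) (s : k.-tuple G) :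
  legal_open_seq s -> k <= grundy_total G.
Proof.
move=> legal_s; have lt_k : k < #|G|.+1.
  case/andP: legal_s => /card_uniqP card_s _.
  by rewrite ltnS -(size_tuple s) -card_s max_card.
apply: (@leq_bigmax_cond _ _ (fun i : 'I_#|G|.+1 => i : nat) (Ordinal lt_k)).
by apply/existsP; exists s.
Qed.

Lemma grundy_total_attained (G : sgraph) :
  exists s : (grundy_total G).-tuple G, legal_open_seq s.
Proof.
pose P (k : 'I_#|G|.+1) := [exists s : k.-tuple G, legal_open_seq s].
have P0 : P ord0.
  by apply/existsP; exists [tuple]; apply/andP; split=> //; apply/forallP; case.
have [k Pk eq_k] : {k | k \in P & grundy_total G = k}.
  by apply: eq_bigmax_cond; apply/card_gt0P; exists ord0.
by rewrite eq_k; exact/existsP.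
Qed.

Definition dprod_adj (G H : sgraph) : rel (G * H) :=
  fun x y => adj x.1 y.1 && adj x.2 y.2.

Lemma dprod_adj_sym (G H : sgraph) : symmetric (@dprod_adj G H).
Proof. by move=> x y; rewrite /dprod_adj adj_sym [adj x.2 _]adj_sym. Qed.

Lemma dprod_adj_irrefl (G H : sgraph) : irreflexive (@dprod_adj G H).
Proof. by move=> x; rewrite /dprod_adj adj_irrefl. Qed.

Definition direct_product (G H : sgraph) : sgraph :=
  SGraph (@dprod_adj_sym G H) (@dprod_adj_irrefl G H).

(* Main.v *)
Require Import Defs.
From mathcomp Require Import all_boot.

(** If [u_i] is adjacent to [g_i] but to no earlier term of a legal sequence of
    [G], and [w_j] is likewise for [h_j] in [H], then the pairs [(g_i, h_j)]
    listed lexicographically form a legal sequence of the product: [(u_i, w_j)]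
    is adjacent to [(g_i, h_j)] but to no lexicographically smaller pair. *)

(** Trades set differences for explicit witnesses [f i], which can be paired coordinatewise in a
    product. *)
Lemma legal_open_seqP (G : sgraph) (k : nat) (s : k.-tuple G) :
  reflect (exists f : 'I_k -> G,
             forall i, adj (tnth s i) (f i) /\
                       forall j : 'I_k, j < i -> ~~ adj (tnth s j) (f i))
          (legal_open_seq s).
Proof.
apply: (iffP andP) => [[_ /forallP footprint]|[f fP]].
  have w_ex i : exists w, w \in open_nbhd (tnth s i)
      :\: \bigcup_(j < k | j < i) open_nbhd (tnth s j).
    exact/set0Pn/footprint.
  exists (fun i => xchoose (w_ex i)) => i.
  have := xchooseP (w_ex i); set w := xchoose _.
  rewrite inE inE => /andP[not_earlier ->]; split=> // j lt_ji.
  apply: contra not_earlier => adj_jw.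
  by apply/bigcupP; exists j; rewrite ?inE.
split.
  (* Distinctness is automatic: if a vertex recurred, the witness of its later occurrence would be
     adjacent to the earlier one. *)
  apply/tuple_uniqP => i j eq_s; apply/val_inj.
  have [lt_ij|lt_ji|//] := ltngtP i j.
    by have [adj_j /(_ i lt_ij)] := fP j; rewrite eq_s adj_j.
  by have [adj_i /(_ j lt_ji)] := fP i; rewrite -eq_s adj_i.
apply/forallP => i; apply/set0Pn; exists (f i); have [adj_i not_adj] := fP i.
rewrite inE inE adj_i andbT; apply/bigcupP => -[j lt_ji].
by rewrite inE (negPf (not_adj j lt_ji)).
Qed.

Lemma legal_direct_product (G H : sgraph) (m n : nat)
    (s : m.-tuple G) (t : n.-tuple H) :
  legal_open_seq s -> legal_open_seq t ->
  exists r : (m * n).-tuple (direct_product G H), legal_open_seq r.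
Proof.
move=> /legal_open_seqP[f fP] /legal_open_seqP[g gP].
(* Any index [p] forces [m * n] to be nonzero, so dividing by [n] is meaningful. *)
have n_gt0 (p : 'I_(m * n)) : 0 < n.
  by case: n p {t g gP} => [|//]; rewrite muln0 => -[].
have lt_q (p : 'I_(m * n)) : p %/ n < m by rewrite ltn_divLR ?(n_gt0 p).
have lt_r (p : 'I_(m * n)) : p %% n < n by rewrite ltn_mod (n_gt0 p).
pose q p := Ordinal (lt_q p); pose r p := Ordinal (lt_r p).
exists [tuple ((tnth s (q p), tnth t (r p)) : direct_product G H) | p < m * n].
apply/legal_open_seqP; exists (fun p => (f (q p), g (r p))) => p.
have [adj_f nadj_f] := fP (q p); have [adj_g nadj_g] := gP (r p).
split=> [|p' lt_p]; rewrite tnth_mktuple /= /dprod_adj /=.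
  by rewrite adj_f adj_g.
(* A smaller quotient breaks adjacency in [G]; otherwise [p' < p] makes the quotients equal and the
   remainder smaller, which breaks it in [H]. *)
rewrite negb_and; have [lt_qq|le_qq] := ltnP (p' %/ n) (p %/ n).
  by rewrite nadj_f.
have eq_qq : p' %/ n = p %/ n.
  by apply/eqP; rewrite eqn_leq le_qq leq_div2r // ltnW.
rewrite nadj_g ?orbT //=.
by move: lt_p; rewrite {1}(divn_eq p' n) {1}(divn_eq p n) eq_qq ltn_add2l.
Qed.

Theorem lemma2p1 (G H : sgraph) :
  grundy_total G * grundy_total H <= grundy_total (direct_product G H).
Proof.
have [s legal_s] := grundy_total_attained G.
have [t legal_t] := grundy_total_attained H.
have [r legal_r] := legal_direct_product _ _ _ _ _ _ legal_s legal_t.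
exact: leq_grundy_total legal_r.
Qed.
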